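(* Let $G$ be a chain roadmap with $n$ viewpoints and let $m<n$ be the number of robots. Then $\mathrm{RT}^*=2\min_{\Pi_m}\dim(\Pi_m)$, where the minimum is over all $m$-partitions $\Pi_m$ of the set of viewpoints.
   Context: A chain roadmap has viewpoints $1,\dots,n$ and edges $\{i,i+1\}$ with positive lengths; points are identified with their distance from vertex $1$, so viewpoints are reals $0=v_1<\dots<v_n$, $V=\{v_1,\dots,v_n\}$. A team trajectory is $X=(x_1,\dots,x_m)$, $x_i:[0,T_f]\to[0,v_n]$ continuous, piecewise differentiable, speed at most $1$, where $T_f$ is a fixed horizon much larger than the time a single robot needs to visit all viewpoints. Robot $i$ visits $v$ at $t$ if $x_i(t)=v$. $\mathrm{RT}(X)=\max_v\max_{(t_1,t_2)\in\Omega(v,X)}(t_2-t_1)$ with $\Omega(v,X)=\{(t_1,t_2)\in[0,T_f]^2:t_1\le t_2,\ x_i(t)\ne v\ \forall i,\ \forall t\in(t_1,t_2)\}$, and $\mathrm{RT}^*=\min_X\mathrm{RT}(X)$. An $m$-partition of $V$ is a collection $\Pi_m=\{\pi_1,\dots,\pi_m\}$ of pairwise disjoint (possibly empty) subsets with union $V$; its dimension is $\dim(\Pi_m)=\max_{i}(\max_{v\in\pi_i}v-\min_{v\in\pi_i}v)$, with the inner term $0$ if $\pi_i=\emptyset$. *)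

(* Defs.v *)
From HB Require Import structures.
From mathcomp Require Import all_boot all_order all_algebra.
From mathcomp Require Import all_classical all_reals all_analysis.

Set Implicit Arguments.
Unset Strict Implicit.
Unset Printing Implicit Defensive.

Import Order.TTheory GRing.Theory Num.Theory.
Import numFieldNormedType.Exports.

Local Open Scope classical_set_scope.
Local Open Scope ring_scope.

Section Patrolling.
Variable R : realType.

Definition is_minimum (A : set R) (a : R) : Prop := A a /\ lbound A a.

(* A chain with n.+1 viewpoints, given by their distances from the first. *)
Definition chain_roadmap (n : nat) (v : 'I_n.+1 -> R) : Prop :=
  v ord0 = 0 /\ forall i j : 'I_n.+1, (i < j)%N -> v i < v j.

Section Trajectories.
Variables (n : nat) (v : 'I_n.+1 -> R) (m : nat) (Tf : R).

(* Only the values of x on [0, Tf] matter.  The sequence s lists the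
   breakpoints; off s the derivative exists and bounds the speed. *)
Definition robot_trajectory (x : R -> R) : Prop :=
  [/\ {within `[0, Tf], continuous x},
      forall t : R, t \in `[0, Tf] -> x t \in `[0, v ord_max] &
      exists s : seq R, forall t : R, t \in `]0, Tf[ -> t \notin s ->
        derivable x t 1 /\ `|derive1 x t| <= 1].

Definition team_trajectory (X : 'I_m -> R -> R) : Prop :=
  forall i, robot_trajectory (X i).

Definition Omega (i : 'I_n.+1) (X : 'I_m -> R -> R) : set (R * R) :=
  [set p | [/\ p.1 \in `[0, Tf], p.2 \in `[0, Tf], p.1 <= p.2 &
    forall (k : 'I_m) (t : R), t \in `]p.1, p.2[ -> X k t != v i]].

(* The inner sup is over a nonempty set bounded by Tf, of nonnegative lengths,
   and is attained when the trajectories are continuous. *)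
Definition refresh_time (X : 'I_m -> R -> R) : R :=
  \big[Num.max/0]_(i < n.+1) sup [set p.2 - p.1 | p in Omega i X].

End Trajectories.

Section Partitions.
Variables (n : nat) (v : 'I_n.+1 -> R) (m : nat).

(* Subsets of V are represented by the sets of indices of their elements. *)
Definition m_partition (P : 'I_m -> {set 'I_n.+1}) : Prop :=
  (forall k l : 'I_m, k != l -> (P k :&: P l = finset.set0)%SET) /\
  (\bigcup_(k < m) P k = [set: 'I_n.+1])%SET.

(* The default values v ord0 and v ord_max are the least and the greatest
   viewpoint, so for nonempty A the two big operators are max and min over A. *)
Definition extent (A : {set 'I_n.+1}) : R :=
  if A == finset.set0 then 0
  else \big[Num.max/v ord0]_(i in A) v i - \big[Num.min/v ord_max]_(i in A) v i.

Definition partition_dim (P : 'I_m -> {set 'I_n.+1}) : R :=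
  \big[Num.max/0]_(k < m) extent (P k).

End Partitions.
End Patrolling.

(* Main.v *)
(** Lower bound. Let [D] be the least partition dimension. Greedy clustering
    from the left yields viewpoints [w 0, ..., w m] with consecutive gaps at
    least [D]. If the refresh time were below [2 * c] with [c < D], then every
    window of length [2 * c] would contain a visit to each [w j]. At a visit to
    [w j.+1], the robots that were at or left of [w j] less than [c] earlier or
    later are still left of [w j.+1], so by induction at least [j.+1] robots are
    at or left of [w j] at some time near any [t] far enough from the ends of
    the horizon. For [j = m] that is more than [m] robots. This replaces the
    usual reordering of the robots into non-crossing trajectories.

    Upper bound. Each robot sweeps the convex hull of its block back and forth,
    along a triangle wave whose period is twice the extent of the block. *)

Require Import Defs.
From HB Require Import structures.
From mathcomp Require Import all_boot all_order all_algebra.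
From mathcomp Require Import all_classical all_reals all_analysis.
From mathcomp Require Import lra ring.

Set Implicit Arguments.
Unset Strict Implicit.
Unset Printing Implicit Defensive.

Import Order.TTheory GRing.Theory Num.Theory.
Import numFieldNormedType.Exports.

Local Open Scope classical_set_scope.
Local Open Scope ring_scope.

(** * Trajectories are 1-Lipschitz *)

(** Induction on the breakpoints: the mean value theorem when there are none. A breakpoint inside
    the interval splits it and the two bounds add up; one outside is dropped. *)
Lemma piecewise_derivable_dist_le (R : realType) (x : R -> R) (s : seq R)
    (a b : R) :
  a <= b -> {within `[a, b], continuous x} ->
  (forall t, t \in `]a, b[ -> t \notin s ->
    derivable x t 1 /\ `|derive1 x t| <= 1) ->
  `|x b - x a| <= b - a.
Proof.
elim: s a b => [|p s IHs] a b ab cx dx.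
  have [->|neq_ab] := eqVneq a b; first by rewrite !subrr normr0.
  have lt_ab : a < b by rewrite lt_neqAle neq_ab.
  have dx' t : t \in `]a, b[ -> is_derive t 1 x (derive1 x t).
    by move=> tab; rewrite derive1E; apply: derivableP; have [] := dx t tab.
  have [d dab ->] := MVT lt_ab dx' cx.
  rewrite normrM (ger0_norm (_ : 0 <= b - a)) ?subr_ge0//.
  by rewrite ler_piMl ?subr_ge0//; have [] := dx d dab.
have [pab|pab] := boolP (p \in `]a, b[); last first.
  apply: IHs => // t tab ts; apply: dx => //.
  rewrite inE negb_or ts andbT; apply: contraNneq pab => <-//.
move: (pab); rewrite in_itv /= => /andP[ap pb].
have Hl : `|x p - x a| <= p - a.
  apply: IHs; first exact: ltW.
    apply: continuous_subspaceW cx => t /=; rewrite !in_itv /= => /andP[-> tp].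
    by rewrite (le_trans tp) ?ltW.
  move=> t; rewrite in_itv /= => /andP[at' tp] ts; apply: dx.
    by rewrite in_itv /= at' (lt_trans tp).
  by rewrite inE negb_or ts (lt_eqF tp).
have Hr : `|x b - x p| <= b - p.
  apply: IHs; first exact: ltW.
    apply: continuous_subspaceW cx => t /=; rewrite !in_itv /= => /andP[pt ->].
    by rewrite andbT (le_trans _ pt) ?ltW.
  move=> t; rewrite in_itv /= => /andP[pt tb] ts; apply: dx.
    by rewrite in_itv /= tb (lt_trans ap).
  by rewrite inE negb_or ts (gt_eqF pt).
rewrite (_ : x b - x a = (x b - x p) + (x p - x a)); last by ring.
by rewrite (le_trans (ler_normD _ _))//; lra.
Qed.

Lemma robot_trajectory_dist_le (R : realType) (n : nat) (v : 'I_n.+1 -> R)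
    (Tf : R) (x : R -> R) (s t : R) :
  robot_trajectory v Tf x -> s \in `[0, Tf] -> t \in `[0, Tf] ->
  `|x t - x s| <= `|t - s|.
Proof.
move=> [cx _ [brk dx]].
wlog st : s t / s <= t => [H|].
  have [st|/ltW ts] := leP s t; first exact: H.
  by move=> s0 t0; rewrite distrC [leRHS]distrC; exact: H.
rewrite !in_itv /= => /andP[s0 sT] /andP[t0 tT].
rewrite (ger0_norm (_ : 0 <= t - s)) ?subr_ge0//.
apply: (piecewise_derivable_dist_le (s := brk)) => //.
  apply: continuous_subspaceW cx => u /=; rewrite !in_itv /= => /andP[su ut].
  by rewrite (le_trans s0 su) (le_trans ut tT).
move=> u; rewrite in_itv /= => /andP[su ut]; apply: dx.
by rewrite in_itv /= (le_lt_trans s0 su) (lt_le_trans ut tT).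
Qed.

(** * Visits forced by a small refresh time *)

Lemma Omega_length_le (R : realType) (n : nat) (v : 'I_n.+1 -> R) (m : nat)
    (Tf : R) (X : 'I_m -> R -> R) (i : 'I_n.+1) (p : R * R) :
  Omega v Tf i X p -> p.2 - p.1 <= refresh_time v Tf X.
Proof.
move=> Op; apply: le_trans (le_bigmax _ _ i).
apply: ub_le_sup; last by exists p.
exists Tf => _ [q [+ + _ _] <-]; rewrite !in_itv /=; lra.
Qed.

(** The bounds on [t] keep the window around it inside the horizon; without a visit it would be a
    gap of length [2 * c] in [Omega]. *)
Lemma visit_within (R : realType) (n : nat) (v : 'I_n.+1 -> R) (m : nat)
    (Tf : R) (X : 'I_m -> R -> R) (c t : R) (i : 'I_n.+1) :
  0 < c -> refresh_time v Tf X < 2 * c -> c <= t -> t <= Tf - c ->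
  exists k s, `|s - t| < c /\ X k s = v i.
Proof.
move=> c0 RTc ct tT; apply: contrapT => novisit.
have Op : Omega v Tf i X (t - c, t + c).
  split; rewrite ?in_itv /=; [lra|lra|lra|].
  move=> k s; rewrite in_itv /= => ts; apply/eqP => Xs; apply: novisit.
  by exists k, s; split; rewrite // ltr_norml; lra.
by have := Omega_length_le Op; rewrite /=; lra.
Qed.

Lemma trapped_robots (R : realType) (n : nat) (v : 'I_n.+1 -> R) (m : nat)
    (Tf : R) (X : 'I_m -> R -> R) (c : R) (w : nat -> 'I_n.+1) (j : nat) :
  team_trajectory v Tf X -> 0 < c -> refresh_time v Tf X < 2 * c ->
  (forall l, (l < j)%N -> v (w l) + c < v (w l.+1)) ->
  forall t, j.+1%:R * c <= t -> t <= Tf - j.+1%:R * c ->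
  exists s, `|s - t| < c /\ (j < #|[set k | (X k s <= v (w j))%R]%SET|)%N.
Proof.
move=> trajX c0 RTc; elim: j => [|j IHj] wc t.
  rewrite mul1r => ct tT; have [k [s [st Xs]]] := visit_within (w 0%N) c0 RTc ct tT.
  by exists s; split=> //; apply/card_gt0P; exists k; rewrite inE Xs.
rewrite -[j.+2%:R]natr1 mulrDl mul1r => tlo thi.
have jc : 0 < j.+1%:R * c by rewrite mulr_gt0.
have [k [s [st Xs]]] : exists k s, `|s - t| < c /\ X k s = v (w j.+1).
  by apply: (visit_within _ c0 RTc); lra.
have /andP[slo shi] : t - c < s < t + c by rewrite -ltr_distl.
have [||| u [us cardu]] := IHj _ s; [by move=> l lj; exact: wc (leqW lj)|lra|lra|].
have /andP[ulo uhi] : s - c < u < s + c by rewrite -ltr_distl.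
exists s; split=> //.
(* Robot [k] is new: it is at [w j.+1] at time [s], more than [c] to the right of [w j], and [u] is
   less than [c] away from [s]. *)
apply: leq_trans (_ : #|k |: [set l | (X l u <= v (w j))%R]|%SET <= _)%N.
  rewrite cardsU1 inE; case: leP => [Xku|_] /=; last by rewrite add1n ltnS.
  have := robot_trajectory_dist_le (trajX k) (_ : u \in `[0, Tf]) (_ : s \in `[0, Tf]).
  have jc1 : c <= j.+1%:R * c by rewrite ler_peMl ?ler1n ?ltW.
  rewrite !in_itv /= Xs => /(_ ltac:(lra) ltac:(lra)).
  rewrite [X in _ <= X]distrC => dku.
  have := le_trans (ler_norm _) dku; have := wc j (ltnSn j); lra.
apply/subset_leq_card/fintype.subsetP => l; rewrite !inE => /orP[/eqP->|Xl].
  by rewrite Xs.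
have jc1 : c <= j.+1%:R * c by rewrite ler_peMl ?ler1n ?ltW.
have := robot_trajectory_dist_le (trajX l) (_ : u \in `[0, Tf]) (_ : s \in `[0, Tf]).
rewrite !in_itv /= => /(_ ltac:(lra) ltac:(lra)).
rewrite [X in _ <= X]distrC => dlu.
have := le_trans (ler_norm _) dlu; have := wc j (ltnSn j); lra.
Qed.

(** * Greedy clustering *)

Lemma chain_le (R : realType) (n : nat) (v : 'I_n.+1 -> R) (i j : 'I_n.+1) :
  chain_roadmap v -> (i <= j)%N -> v i <= v j.
Proof.
move=> [_ v_incr]; rewrite leq_eqVlt => /orP[/eqP/val_inj->//|ij].
exact/ltW/v_incr.
Qed.

Lemma chain_ge0 (R : realType) (n : nat) (v : 'I_n.+1 -> R) (i : 'I_n.+1) :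
  chain_roadmap v -> 0 <= v i.
Proof. by move=> hv; rewrite -(proj1 hv); exact: chain_le. Qed.

Lemma chain_le_max (R : realType) (n : nat) (v : 'I_n.+1 -> R) (i : 'I_n.+1) :
  chain_roadmap v -> v i <= v ord_max.
Proof. by move=> hv; apply: chain_le => //; rewrite -ltnS. Qed.

(** The first cluster runs from [p] up to the first viewpoint [q] at distance at least [D] from [p];
    the recursion continues from [q] with one cluster fewer. If the clusters run out, their starting
    points form [w]. *)
Lemma greedy_clustering (R : realType) (n : nat) (v : 'I_n.+1 -> R) (D : R)
    (m : nat) (p : 'I_n.+1) :
  chain_roadmap v ->
  (exists c : 'I_n.+1 -> nat, (forall i : 'I_n.+1, (p <= i)%N -> (c i < m)%N) /\
     forall i j : 'I_n.+1, (p <= i)%N -> (p <= j)%N -> c i = c j -> v i - v j < D) \/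
  exists w : nat -> 'I_n.+1, w 0%N = p /\
     forall l, (l < m)%N -> v (w l) + D <= v (w l.+1).
Proof.
move=> hv; elim: m p => [|m IHm] p; first by right; exists (fun=> p).
have [[q0 q0P]|far] := pselect (exists q, v p + D <= v q); last first.
  left; exists (fun=> 0%N); split=> // i j pi pj _.
  rewrite ltNge; apply/negP => Dij; apply: far; exists i.
  by have := chain_le hv pj; lra.
case: (@arg_minnP _ q0 (fun q => v p + D <= v q) (@nat_of_ord _) q0P) => q qP qmin.
have [[c [cm cD]]|[w [w0 wD]]] := IHm q; last first.
  right; exists (fun l => if l is l'.+1 then w l' else p); split=> // -[|l] lm.
    by rewrite w0.
  exact: wD.
(* The label [m] is fresh, since [c] takes values below [m] from [q] on. *)
left; exists (fun i : 'I_n.+1 => if (i < q)%N then m else c i); split=> [i pi|i j pi pj] /=.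
  by case: (ltnP i q) => // qi; exact: leqW (cm i qi).
case: (ltnP i q) => [iq|qi]; case: (ltnP j q) => [jq|qj].
- move=> _; rewrite ltNge; apply/negP => Dij.
  suff /qmin : v p + D <= v i by rewrite leqNgt iq.
  by have := chain_le hv pj; lra.
- by move=> cj; have := cm j qj; rewrite -cj ltnn.
- by move=> ci; have := cm i qi; rewrite ci ltnn.
- exact: cD.
Qed.

Lemma extent_lt (R : realType) (n : nat) (v : 'I_n.+1 -> R) (A : {set 'I_n.+1})
    (D : R) :
  chain_roadmap v -> 0 < D -> (forall i j, i \in A -> j \in A -> v i - v j < D) ->
  extent v A < D.
Proof.
move=> hv D0 AD; rewrite /extent; case: ifPn => // /set0Pn[i0 i0A].
rewrite (@bigmax_eq_arg _ _ _ _ i0)//; last by move=> i _; exact: chain_le.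
rewrite (@bigmin_eq_arg _ _ _ _ i0)//; last by move=> i _; exact: chain_le_max.
by case: arg_maxP => // i iA _; case: arg_minP => // j jA _; exact: AD.
Qed.

(** If clustering succeeded with [m] labels, its classes would form an [m]-partition of dimension
    below [D]. *)
Lemma spread_viewpoints (R : realType) (n : nat) (v : 'I_n.+1 -> R) (m : nat)
    (D : R) :
  chain_roadmap v -> 0 < D ->
  (forall P : 'I_m -> {set 'I_n.+1}, m_partition P -> D <= partition_dim v P) ->
  exists w : nat -> 'I_n.+1, forall l, (l < m)%N -> v (w l) + D <= v (w l.+1).
Proof.
move=> hv D0 Dmin.
have [[c [cm cD]]|[w [_ wD]]] := greedy_clustering D m ord0 hv; last by exists w.
pose P (k : 'I_m) := [set i | c i == k]%SET.
suff /Dmin : m_partition P.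
  rewrite leNgt => /negP[]; apply: bigmax_lt => // k _.
  apply: extent_lt => // i j; rewrite !inE => /eqP ci /eqP cj.
  by apply: cD; rewrite // ci cj.
split=> [k l kl|].
  apply/setP => i; rewrite !inE; apply: contraNF kl => /andP[/eqP ck /eqP cl].
  by apply/eqP/val_inj; rewrite /= -ck -cl.
apply/setP => i; rewrite finset.in_setT; apply/bigcupP.
by exists (Ordinal (cm i (leq0n i))); rewrite // inE.
Qed.

(** * The lower bound *)

Lemma refresh_time_ge0 (R : realType) (n : nat) (v : 'I_n.+1 -> R) (m : nat)
    (Tf : R) (X : 'I_m -> R -> R) :
  0 <= refresh_time v Tf X.
Proof. exact: bigmax_ge_id. Qed.

Lemma refresh_time_ge (R : realType) (n : nat) (v : 'I_n.+1 -> R) (m : nat)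
    (Tf D : R) (X : 'I_m -> R -> R) :
  chain_roadmap v -> (0 < m)%N -> 6 * v ord_max <= Tf -> team_trajectory v Tf X ->
  (forall P : 'I_m -> {set 'I_n.+1}, m_partition P -> D <= partition_dim v P) ->
  2 * D <= refresh_time v Tf X.
Proof.
move=> hv m0 hTf trajX Dmin; rewrite leNgt; apply/negP => RTD.
have RT0 := refresh_time_ge0 v Tf X.
have D0 : 0 < D by lra.
have [w wD] := spread_viewpoints hv D0 Dmin.
(* The midpoint of half the refresh time and [D], hence strictly between them. *)
pose c := (refresh_time v Tf X / 2 + D) / 2.
have c0 : 0 < c by rewrite /c; lra.
have RTc : refresh_time v Tf X < 2 * c by rewrite /c; lra.
have cD : c < D by rewrite /c; lra.
have vw l : (l <= m)%N -> l%:R * D <= v (w l).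
  elim: l => [|l IHl] lm; first by rewrite mul0r chain_ge0.
  by rewrite -natr1 mulrDl mul1r; have := wD l lm; have := IHl (ltnW lm); lra.
have mD := le_trans (vw m (leqnn m)) (chain_le_max _ hv).
(* As [m] is positive, [m + 1] is at most [2 * m], and [m] gaps of length [D] fit on the chain. So
   [Tf / 2] is far enough from both ends of the horizon for [m.+1] rounds of the induction. *)
have mc : m.+1%:R * c <= 2 * v ord_max.
  have : m.+1%:R * c <= m.+1%:R * D by rewrite ler_wpM2l ?ltW.
  have : D <= m%:R * D by rewrite ler_peMl ?ler1n ?ltW.
  by rewrite -natr1 !mulrDl !mul1r; lra.
have vmax0 := chain_ge0 ord_max hv.
have [||| s [_]] := trapped_robots (w := w) (j := m) trajX c0 RTc _ (t := Tf / 2).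
- by move=> l lm; have := wD l lm; lra.
- lra.
- lra.
by rewrite ltnNge; move=> /negP[]; apply: leq_trans (max_card _) _; rewrite card_ord.
Qed.

(** * The triangle wave *)

(** Rounds [t / (2 * d)] to the nearest integer, ties going up. *)
Definition nearest_period (R : realType) (d t : R) : int :=
  Num.floor (t / (2 * d) + 2^-1).

(** The distance from [t] to the lattice of integer multiples of [2 * d]. *)
Definition triangle_wave (R : realType) (d t : R) : R :=
  `|t - 2 * d * (nearest_period d t)%:~R|.

Lemma nearest_period_itv (R : realType) (d t : R) :
  0 < d -> - d <= t - 2 * d * (nearest_period d t)%:~R < d.
Proof.
move=> d0; have /andP[] := floor_itv (t / (2 * d) + 2^-1).
rewrite -/(nearest_period d t) intrD.
have tE : t = 2 * d * (t / (2 * d)) by rewrite mulrC divfK// gt_eqF ?mulr_gt0.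
move: (t / (2 * d)) (nearest_period d t)%:~R tE => y k tE ky yk.
have : 0 <= d * (y + 2^-1 - k) by apply: mulr_ge0; lra.
have : 0 < d * (k + 1 - (y + 2^-1)) by rewrite mulr_gt0 ?subr_gt0.
by rewrite tE => *; apply/andP; split; lra.
Qed.

Lemma triangle_wave_bounds (R : realType) (d t : R) :
  0 < d -> 0 <= triangle_wave d t <= d.
Proof.
move=> d0; rewrite normr_ge0 ler_norml.
by have /andP[-> /ltW] := nearest_period_itv t d0.
Qed.

(** Since [t] is within [d] of the chosen multiple, every other multiple is at distance at least
    [d]. *)
Lemma triangle_wave_le_dist (R : realType) (d t : R) (j : int) :
  0 < d -> triangle_wave d t <= `|t - 2 * d * j%:~R|.
Proof.
move=> d0; have /andP[_ Td] := triangle_wave_bounds t d0.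
have /andP[kt tk] := nearest_period_itv t d0.
have [jk|kj|->//] := ltgtP j (nearest_period d t).
- have {}jk : j%:~R + 1 <= (nearest_period d t)%:~R :> R by rewrite -intrD1 ler_int lezD1.
  have : d * (j%:~R + 1) <= d * (nearest_period d t)%:~R by rewrite ler_pM2l.
  by have := ler_norm (t - 2 * d * j%:~R); lra.
- have {}kj : (nearest_period d t)%:~R + 1 <= j%:~R :> R by rewrite -intrD1 ler_int lezD1.
  have : d * ((nearest_period d t)%:~R + 1) <= d * j%:~R by rewrite ler_pM2l.
  by have := ler_norm (- (t - 2 * d * j%:~R)); rewrite normrN; lra.
Qed.

(** A distance to a set is 1-Lipschitz: compare both points with the lattice point chosen for one of
    them. *)
Lemma triangle_wave_dist_le (R : realType) (d s t : R) :
  0 < d -> `|triangle_wave d t - triangle_wave d s| <= `|t - s|.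
Proof.
move=> d0.
have le u w : triangle_wave d u - triangle_wave d w <= `|u - w|.
  rewrite lerBlDr (le_trans (triangle_wave_le_dist u (nearest_period d w) d0))//.
  exact: ler_distD.
by rewrite ler_norml lerNl opprB le distrC le.
Qed.

Lemma triangle_wave_continuous (R : realType) (d : R) :
  0 < d -> continuous (triangle_wave d).
Proof.
move=> d0 t; apply/cvgrPdist_lt => e e0; apply/nbhs_ballP; exists e => //= s.
by rewrite /ball /=; apply: le_lt_trans; exact: triangle_wave_dist_le.
Qed.

(** A multiple within [d] of [t] is a nearest one; in a tie, both candidates give the value [d]. *)
Lemma triangle_wave_dist (R : realType) (d t : R) (j : int) :
  0 < d -> `|t - 2 * d * j%:~R| <= d ->
  triangle_wave d t = `|t - 2 * d * j%:~R|.
Proof.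
move=> d0 tjd; apply/le_anti; rewrite triangle_wave_le_dist//=.
have /andP[jt tj] : - d <= t - 2 * d * j%:~R <= d by rewrite -ler_norml.
rewrite /triangle_wave; have [jk|kj|->//] := ltgtP j (nearest_period d t).
- have {}jk : j%:~R + 1 <= (nearest_period d t)%:~R :> R by rewrite -intrD1 ler_int lezD1.
  have : d * (j%:~R + 1) <= d * (nearest_period d t)%:~R by rewrite ler_pM2l.
  by have := ler_norm (- (t - 2 * d * (nearest_period d t)%:~R)); rewrite normrN; lra.
- have {}kj : (nearest_period d t)%:~R + 1 <= j%:~R :> R by rewrite -intrD1 ler_int lezD1.
  have : d * ((nearest_period d t)%:~R + 1) <= d * j%:~R by rewrite ler_pM2l.
  by have := ler_norm (t - 2 * d * (nearest_period d t)%:~R); lra.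
Qed.

Lemma triangle_wave_periodic (R : realType) (d p : R) (j : int) :
  0 < d -> 0 <= p <= d -> triangle_wave d (2 * d * j%:~R + p) = p.
Proof.
move=> d0 /andP[p0 pd].
have pE : 2 * d * j%:~R + p - 2 * d * j%:~R = p by rewrite addrAC subrr add0r.
by rewrite (triangle_wave_dist (j := j)) ?pE// ger0_norm.
Qed.

(** The corners are the multiples of [d]. Elsewhere the wave agrees near [t] with [c - id] or
    [id - c], where [c] is the nearest multiple of [2 * d]. *)
Lemma triangle_wave_is_derive (R : realType) (d t : R) :
  0 < d -> (forall z : int, t != d * z%:~R) ->
  exists2 e, `|e| <= 1 & is_derive t 1 (triangle_wave d) e.
Proof.
move=> d0 tNd; have := nearest_period_itv t d0.
set c := 2 * d * _ => /andP[ct tc].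
have waveE (u : R) : `|u - c| <= d -> triangle_wave d u = `|u - c|.
  exact: triangle_wave_dist.
have cE : c = d * (2 * nearest_period d t)%:~R by rewrite intrM /c; ring.
have ctE : c - d = d * (2 * nearest_period d t - 1)%:~R.
  by rewrite intrB mulrBr mulr1 -cE.
have {}ct : - d < t - c.
  rewrite lt_neqAle ct andbT; apply: contra (tNd (2 * nearest_period d t - 1)).
  by rewrite -ctE => /eqP dE; apply/eqP; lra.
have /lt_total/orP[tc0|tc0] : t != c by rewrite cE.
- exists (-1); first by rewrite normrN1.
  apply: (@near_eq_is_derive _ _ _ (cst c - id)); last first.
    by rewrite -[X in is_derive _ _ _ X]sub0r; apply: is_deriveB.
  (* The radius is the distance from [t] to the closer end of the linear piece between [c - d] and
     [c]. *)
  apply/nbhs_ballP; exists (Num.min (c - t) (t - c + d)) => /=.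
    by rewrite lt_min; apply/andP; split; lra.
  move=> u; rewrite /ball /= lt_min !ltr_norml => ut.
  by rewrite waveE ?ler_norml ?ltr0_norm ?opprB//; lra.
- exists 1; first by rewrite normr1.
  apply: (@near_eq_is_derive _ _ _ (id - cst c)); last first.
    by rewrite -[X in is_derive _ _ _ X]subr0; apply: is_deriveB.
  apply/nbhs_ballP; exists (Num.min (t - c) (c + d - t)) => /=.
    by rewrite lt_min; apply/andP; split; lra.
  move=> u; rewrite /ball /= lt_min !ltr_norml => ut.
  by rewrite waveE ?ler_norml ?gtr0_norm//; lra.
Qed.

(** * Sweeping the blocks of a partition *)

(** The case [d = 0] is separate because, division by zero being zero, [triangle_wave 0 t] is the
    absolute value of [t], not a constant. *)
Definition sweep (R : realType) (lo d t : R) : R :=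
  if d == 0 then lo else lo + triangle_wave d t.

Lemma sweep_trajectory (R : realType) (n : nat) (v : 'I_n.+1 -> R) (Tf lo d : R) :
  0 <= lo -> 0 <= d -> lo + d <= v ord_max -> robot_trajectory v Tf (sweep lo d).
Proof.
move=> lo0 d0 hid; have [dz|dn0] := eqVneq d 0.
  have -> : sweep lo d = cst lo by apply/funext => t; rewrite /sweep dz eqxx.
  split.
  - by apply: continuous_subspaceT; exact: cst_continuous.
  - by move=> t _; rewrite in_itv /= lo0; lra.
  - exists [::] => t _ _; split; first exact: derivable_cst.
    by rewrite derive1_cst normr0.
have {dn0}d0 : 0 < d by rewrite lt_neqAle eq_sym dn0.
have -> : sweep lo d = cst lo + triangle_wave d.
  by apply/funext => t; rewrite /sweep (gt_eqF d0).
split.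
- apply: continuous_subspaceT => t; apply: cvgD; first exact: cvg_cst.
  exact: triangle_wave_continuous.
- move=> t _; rewrite in_itv /= !fctE.
  by have := triangle_wave_bounds t d0; lra.
(* [N] is chosen so that the multiples [d * k] with [k < N] include every corner inside the
   horizon. *)
- have [N TfN] : exists N : nat, Tf / d < N%:R.
    by exists (Num.bound `|Tf / d|); apply: le_lt_trans (ler_norm _) (archi_boundP _).
  exists [seq d * k%:R | k <- iota 0 N] => t.
  rewrite in_itv /= => /andP[t0 tT] tbrk.
  have [|e e1 dwave] := @triangle_wave_is_derive _ d t d0.
    move=> z; apply: contra tbrk => /eqP tE; apply/seq.mapP.
    have z0 : 0 <= z by rewrite -(ler_int R) -(pmulr_rge0 _ d0) -tE ltW.
    case: z z0 tE => // k _ tE; exists k; last by rewrite tE.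
    rewrite mem_iota /= add0n -(ltr_nat R).
    apply: le_lt_trans TfN.
    by rewrite ler_pdivlMr// mulrC -[k%:R]/(k%:~R) -tE ltW.
  have dsum : is_derive t 1 (cst lo + triangle_wave d) (0 + e) by exact: is_deriveD.
  by split=> //; rewrite derive1E derive_val add0r.
Qed.

Lemma sweep_visit (R : realType) (lo d p t1 t2 : R) :
  0 <= d -> lo <= p <= lo + d -> t1 < t2 -> 2 * d < t2 - t1 ->
  exists2 t, t \in `]t1, t2[ & sweep lo d t = p.
Proof.
move=> d0 /andP[lop pd] t12 dt; have [dz|dn0] := eqVneq d 0.
  exists ((t1 + t2) / 2); first by rewrite in_itv /=; lra.
  by rewrite /sweep dz eqxx; lra.
have {dn0}d0 : 0 < d by rewrite lt_neqAle eq_sym dn0.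
(* The robot is at [p] at the times [2 * d * j + (p - lo)] for integer [j], and [t1] corresponds to
   [j = y]. Thus [floor y + 1] gives a visit strictly after [t1] and at most one period later. *)
pose y := (t1 - (p - lo)) / (2 * d).
have t1E : t1 = 2 * d * y + (p - lo) 
  by rewrite /y [_ * (_ / _)]mulrC divfK ?subrK// gt_eqF ?mulr_gt0.
exists (2 * d * (Num.floor y + 1)%:~R + (p - lo)); last first.
  rewrite /sweep (gt_eqF d0) triangle_wave_periodic//; first lra.
  by apply/andP; split; lra.
have /andP[yl yu] := floor_itv y.
have : 0 < d * ((Num.floor y + 1)%:~R - y) by rewrite mulr_gt0 ?subr_gt0.
have : 0 <= d * (y - (Num.floor y)%:~R) by apply: mulr_ge0; lra.
by rewrite in_itv /= intrD1; lra.
Qed.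

(* Equal to [v ord_max] when [A] is empty, so that an idle robot stays on the
   roadmap. *)
Definition leftmost (R : realType) (n : nat) (v : 'I_n.+1 -> R)
    (A : {set 'I_n.+1}) : R :=
  \big[Num.min/v ord_max]_(i in A) v i.

Lemma leftmost_ge0 (R : realType) (n : nat) (v : 'I_n.+1 -> R) (A : {set 'I_n.+1}) :
  chain_roadmap v -> 0 <= leftmost v A.
Proof. by move=> hv; apply: le_bigmin => [|i _]; exact: chain_ge0. Qed.

Lemma mem_leftmost_extent (R : realType) (n : nat) (v : 'I_n.+1 -> R)
    (A : {set 'I_n.+1}) (i : 'I_n.+1) :
  i \in A -> leftmost v A <= v i <= leftmost v A + extent v A.
Proof.
move=> iA; rewrite /extent; case: ifPn => [/eqP A0|_].
  by move: iA; rewrite A0 inE.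
by rewrite addrC subrK; apply/andP; split; [exact: bigmin_le_cond|exact: le_bigmax_cond].
Qed.

Lemma extent_ge0 (R : realType) (n : nat) (v : 'I_n.+1 -> R) (A : {set 'I_n.+1}) :
  0 <= extent v A.
Proof.
have [->|/set0Pn[i iA]] := eqVneq A finset.set0; first by rewrite /extent eqxx.
by have := mem_leftmost_extent v iA; lra.
Qed.

Lemma leftmost_extent_le (R : realType) (n : nat) (v : 'I_n.+1 -> R)
    (A : {set 'I_n.+1}) :
  chain_roadmap v -> leftmost v A + extent v A <= v ord_max.
Proof.
move=> hv; rewrite /extent; case: ifPn => _; first by rewrite addr0; exact: bigmin_le_id.
by rewrite addrC subrK; apply: bigmax_le => [|i _]; exact: chain_le_max.
Qed.

Definition sweeping_team (R : realType) (n : nat) (v : 'I_n.+1 -> R) (m : nat)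
    (P : 'I_m -> {set 'I_n.+1}) (k : 'I_m) : R -> R :=
  sweep (leftmost v (P k)) (extent v (P k)).

Lemma sweeping_team_trajectory (R : realType) (n : nat) (v : 'I_n.+1 -> R)
    (m : nat) (Tf : R) (P : 'I_m -> {set 'I_n.+1}) :
  chain_roadmap v -> team_trajectory v Tf (sweeping_team v P).
Proof.
move=> hv k; apply: sweep_trajectory.
- exact: leftmost_ge0.
- exact: extent_ge0.
- exact: leftmost_extent_le.
Qed.

Lemma sweeping_team_refresh_time (R : realType) (n : nat) (v : 'I_n.+1 -> R)
    (m : nat) (Tf : R) (P : 'I_m -> {set 'I_n.+1}) :
  0 <= Tf -> m_partition P ->
  refresh_time v Tf (sweeping_team v P) <= 2 * partition_dim v P.
Proof.
move=> Tf0 [_ coverP].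
have D0 : 0 <= partition_dim v P by exact: bigmax_ge_id.
apply: bigmax_le => [|i _]; first by rewrite mulr_ge0.
have /bigcupP[k _ iPk] : i \in (\bigcup_(k < m) P k)%SET by rewrite coverP finset.in_setT.
have kD : extent v (P k) <= partition_dim v P by exact: (le_bigmax _ _ k).
apply: ge_sup => [|_ [[t1 t2] [_ _ /= t12 novisit] <-]].
  (* The supremum is over a nonempty set: the pair [(0, 0)] bounds an empty open interval. *)
  exists 0, (0, 0); rewrite /= ?subrr//.
  by split; rewrite /= ?in_itv /= ?lexx// => l t; rewrite in_itv /=; lra.
rewrite leNgt; apply/negP => Dt.
(* A gap above twice the dimension exceeds the sweep period of the robot [k] whose block contains
   [i]. *)
have [||t tt /eqP] := sweep_visit (t1 := t1) (t2 := t2) (extent_ge0 v (P k))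
  (mem_leftmost_extent v iPk); [lra|lra|].
by apply/negP; exact: (novisit k t tt).
Qed.

(** * An optimal partition and the conclusion *)

(** There are finitely many partitions once they are encoded as finite functions, and at least one:
    [P0] gives every viewpoint to a single robot. *)
Lemma min_partition_exists (R : realType) (n : nat) (v : 'I_n.+1 -> R) (m : nat) :
  (0 < m)%N ->
  exists2 P : 'I_m -> {set 'I_n.+1}, m_partition P &
    forall Q : 'I_m -> {set 'I_n.+1}, m_partition Q ->
      partition_dim v P <= partition_dim v Q.
Proof.
move=> m0; pose k0 := Ordinal m0.
pose P0 := [ffun k : 'I_m => if k == k0 then [set: 'I_n.+1]%SET else finset.set0].
have P0P : `[< m_partition P0 >].
  apply/asboolP; split=> [k l kl|].
    rewrite !ffunE; case: eqP => [kE|_]; last by rewrite finset.set0I.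
    by case: eqP => [lE|_]; [move: kl; rewrite kE lE eqxx|rewrite finset.setI0].
  apply/setP => i; rewrite finset.in_setT; apply/bigcupP; exists k0 => //.
  by rewrite ffunE eqxx finset.in_setT.
case: (arg_minP (P := fun P : {ffun 'I_m -> {set 'I_n.+1}} => `[< m_partition P >])
  (fun P : {ffun 'I_m -> {set 'I_n.+1}} => partition_dim v P) P0P) => P /asboolP PP Pmin.
exists P => // Q QP.
have QE : Q = [ffun k => Q k] :> ('I_m -> _) by apply/funext => k; rewrite ffunE.
by rewrite QE; apply: Pmin; apply/asboolP; rewrite -QE.
Qed.

(* A single robot needs time v ord_max to visit all viewpoints; hTf is implied
   by any reading of a horizon much larger than that time. *)
Theorem mainTheorem4 (R : realType) (n : nat) (v : 'I_n.+1 -> R) (m : nat)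
    (Tf : R) (hv : chain_roadmap v) (hm0 : (0 < m)%N) (hm : (m < n.+1)%N)
    (hTf : 6 * v ord_max <= Tf) :
  exists RTstar D : R,
    [/\ is_minimum
          [set refresh_time v Tf X | X in [set X : 'I_m -> R -> R | team_trajectory v Tf X]]
          RTstar,
        is_minimum
          [set partition_dim v P | P in [set P : 'I_m -> {set 'I_n.+1} | m_partition P]]
          D &
        RTstar = 2 * D].
Proof.
have [P PP Pmin] := min_partition_exists v hm0.
have Tf0 : 0 <= Tf by have := chain_ge0 ord_max hv; lra.
have trajP := sweeping_team_trajectory Tf P hv.
exists (2 * partition_dim v P), (partition_dim v P); split=> //; split.
(* The team sweeping an optimal partition attains the lower bound. *)
- exists (sweeping_team v P) => //; apply/le_anti/andP; split.
    exact: sweeping_team_refresh_time.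
  exact: refresh_time_ge.
- by move=> _ [X trajX <-]; exact: refresh_time_ge.
- by exists P.
- by move=> _ [Q QP <-]; exact: Pmin.
Qed.
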